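(* Let $X\subset\mathbb{R}^d$ be a linearly repetitive Delone set with constant $L$. If $X'\subset\mathbb{R}^d$ is a non periodic Delone set and $\pi:(\Omega_X,\mathbb{R}^d)\to(\Omega_{X'},\mathbb{R}^d)$ is a factor map, then $\pi$ is finite-to-one with constant $(55L^2)^d$, i.e. $|\pi^{-1}(\{Y\})|\le(55L^2)^d$ for every $Y\in\Omega_{X'}$.
   Context: Delone sets. $B_R(y)$ is the open Euclidean ball of radius $R$ centered at $y\in\mathbb{R}^d$. For $r,R>0$, an $(r,R)$-Delone set is a discrete set $X\subset\mathbb{R}^d$ such that every open ball of radius $r$ contains at most one point of $X$ and every closed ball of radius $R$ contains at least one point of $X$; a Delone set is an $(r,R)$-Delone set for some $r,R>0$. $X$ is of finite type if $X-X$ meets every bounded set in a finite set; all Delone sets are assumed to be of finite type. $X$ is non periodic if $X-v=X$ implies $v=0$. Delone systems. Let $\mathcal{D}$ be the collection of Delone sets of $\mathbb{R}^d$, with $\mathbb{R}^d$ acting by $(v,X)\mapsto X-v$, and with the topology induced by the following distance: for $X,X'\in\mathcal{D}$ let $A$ be the set of $\varepsilon\in(0,1/\sqrt2)$ for which there are $v,v'\in B_\varepsilon(0)$ with $(X-v)\cap B_{1/\varepsilon}(0)=(X'-v')\cap B_{1/\varepsilon}(0)$; then $d(X,X')=\inf A$ if $A\neq\emptyset$ and $d(X,X')=1/\sqrt2$ otherwise. $\Omega_X$ is the closure in $\mathcal{D}$ of $\{X+v:v\in\mathbb{R}^d\}$. A factor map $\pi:(\Omega_X,\mathbb{R}^d)\to(\Omega_{X'},\mathbb{R}^d)$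 is a continuous surjective map $\pi:\Omega_X\to\Omega_{X'}$ with $\pi(Y-v)=\pi(Y)-v$ for all $Y\in\Omega_X$, $v\in\mathbb{R}^d$. Linear repetitivity. For $R>0$ and $y\in\mathbb{R}^d$, the $R$-patch of $X$ centered at $y$ is $P=X\cap B_R(y)$. A translated patch of $P$ in $X$ is a set $P-v$ with $P-v=X\cap B_R(y-v)$. $X$ is linearly repetitive with constant $L>0$ if for every patch $P$ of $X$ with at least two points, every ball of radius $L\,\mathrm{diam}(P)$ contains a translated patch of $P$ in $X$. *)

(* Defs.v *)
From HB Require Import structures.
From mathcomp Require Import all_boot all_order all_algebra.
From mathcomp Require Import finmap.
From mathcomp Require Import all_classical all_reals all_analysis.
From mathcomp Require Import ring lra.

Set Implicit Arguments.
Unset Strict Implicit.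
Unset Printing Implicit Defensive.

Import Order.TTheory GRing.Theory Num.Theory.
Import numFieldNormedType.Exports.

Local Open Scope classical_set_scope.
Local Open Scope ring_scope.

Section EuclideanSpace.
Context {R : realType} {d : nat}.
Implicit Types (u v w : 'rV[R]_d) (r : R) (X : set 'rV[R]_d).

(* The library norm [`| v |] on ['rV[R]_d] is the sup norm; it induces the same
   topology and the same bounded sets as [enorm]. *)
Definition enorm v : R := Num.sqrt (\sum_i v 0 i ^+ 2).

Definition eball v r : set 'rV[R]_d := [set w | enorm (w - v) < r].

Definition eclosed_ball v r : set 'rV[R]_d := [set w | enorm (w - v) <= r].

Definition diam X : R := sup [set enorm (xy.1 - xy.2) | xy in X `*` X].

Definition shift X v : set 'rV[R]_d := [set x - v | x in X].

Definition difference_set X : set 'rV[R]_d :=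
  [set xy.1 - xy.2 | xy in X `*` X].

Lemma enorm_ge0 v : 0 <= enorm v.
Proof. exact: sqrtr_ge0. Qed.

Lemma sqr_enorm v : enorm v ^+ 2 = \sum_i v 0 i ^+ 2.
Proof. by rewrite sqr_sqrtr// sumr_ge0// => i _; exact: sqr_ge0. Qed.

Lemma enorm0 : enorm 0 = 0.
Proof. by rewrite /enorm big1 ?sqrtr0// => i _; rewrite mxE expr0n. Qed.

Lemma enorm0_eq0 v : enorm v = 0 -> v = 0.
Proof.
move=> v0; have /eqP : \sum_i v 0 i ^+ 2 = 0 by rewrite -sqr_enorm v0 expr0n.
rewrite psumr_eq0 => [/allP vi|i _]; last exact: sqr_ge0.
apply/rowP => i; rewrite mxE; apply/eqP.
by have := vi i (mem_index_enum _); rewrite sqrf_eq0.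
Qed.

Lemma enormN v : enorm (- v) = enorm v.
Proof.
by congr Num.sqrt; apply: eq_bigr => i _; rewrite mxE sqrrN.
Qed.

Lemma enorm_triangle u v : enorm (u + v) <= enorm u + enorm v.
Proof.
set a := enorm u; set b := enorm v; set S := \sum_i u 0 i * v 0 i.
have a0 : 0 <= a := enorm_ge0 u; have b0 : 0 <= b := enorm_ge0 v.
have SE : enorm (u + v) ^+ 2 = a ^+ 2 + 2 * S + b ^+ 2.
  rewrite !sqr_enorm mulr_sumr -!big_split/=.
  by apply: eq_bigr => i _; rewrite mxE; ring.
have [au|an0] := eqVneq a 0.
  by rewrite (enorm0_eq0 au) add0r lerDr.
have [bv|bn0] := eqVneq b 0.
  by rewrite (enorm0_eq0 bv) addr0 lerDl.
have : 0 <= \sum_i (b * u 0 i - a * v 0 i) ^+ 2.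
  by apply: sumr_ge0 => i _; exact: sqr_ge0.
have -> : \sum_i (b * u 0 i - a * v 0 i) ^+ 2 = 2 * (a * b) * (a * b - S).
  transitivity (b ^+ 2 * a ^+ 2 - 2 * (a * b) * S + a ^+ 2 * b ^+ 2).
    rewrite !sqr_enorm !mulr_sumr -sumrN -!big_split/=.
    by apply: eq_bigr => i _; rewrite -!sqr_enorm -/a -/b; ring.
  by ring.
rewrite pmulr_rge0; last by rewrite mulr_gt0// mulr_gt0// lt_neqAle eq_sym ?an0 ?bn0.
rewrite subr_ge0 => Sab.
rewrite -(@ler_pXn2r _ 2)// ?nnegrE ?addr_ge0 ?enorm_ge0// SE.
by rewrite -/a -/b; nra.
Qed.

Lemma shiftE X v w : shift X v w <-> X (w + v).
Proof.
by split=> [[x Xx <-]|Xw]; [rewrite subrK|exists (w + v) => //; rewrite addrK].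
Qed.

Lemma difference_set_shift X v :
  difference_set (shift X v) = difference_set X.
Proof.
apply/seteqP; split=> [_ [[_ _] [[x Xx <-] [y Xy <-]] <-]|_ [[x y] [Xx Xy] <-]].
  by exists (x, y) => //=; rewrite opprB addrA subrK.
exists (x - v, y - v) => /=; last by rewrite opprB addrA subrK.
by split; [exists x|exists y].
Qed.

(* [isolated X] is the set of isolated points of [X]. *)
Definition is_rR_delone r1 r2 X : Prop :=
  [/\ X `<=` isolated X,
      forall y, is_subset1 (X `&` eball y r1) &
      forall y, X `&` eclosed_ball y r2 !=set0].

Definition finite_type X : Prop :=
  forall B : set 'rV[R]_d, bounded_set B -> finite_set (difference_set X `&` B).

Definition is_delone X : Prop :=
  (exists r1 r2 : R, [/\ 0 < r1, 0 < r2 & is_rR_delone r1 r2 X]) /\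
  finite_type X.

Lemma is_delone_shift X v : is_delone X -> is_delone (shift X v).
Proof.
move=> [[r1 [r2 [r1_gt0 r2_gt0 [Xi X1 X2]]]] Xft]; split; last first.
  by move=> B; rewrite difference_set_shift; exact: Xft.
exists r1, r2; split=> //; split.
- move=> _ [x Xx <-]; have [_ [V xV VX]] := Xi _ Xx.
  split; first by apply/mem_set; exists x.
  exists [set w | V (w + v)].
    have /= := @cvgD _ _ _ (nbhs (x - v)) _ id (cst v) _ _ cvg_id (cvg_cst _).
    by rewrite subrK => /(_ _ _ V xV); apply.
  apply/seteqP; split=> [w [/= Vw /shiftE Xw]|_ ->].
    have : (V `&` X) (w + v) by [].
    by rewrite VX => /= <-; rewrite addrK.
  have [Vx _] : (V `&` X) x by rewrite VX.
  by split=> /=; [rewrite subrK|exists x].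
- move=> y a b [/shiftE Xa ya] [/shiftE Xb yb].
  by apply: (addIr v); apply: (X1 (y + v)); split=> //;
    rewrite /eball/= opprD addrACA subrr addr0.
- move=> y; have [x [Xx xy]] := X2 (y + v); exists (x - v).
  by split; [exists x|rewrite /eclosed_ball/= -addrA -opprD (addrC v)].
Qed.

End EuclideanSpace.

Record delone (R : realType) (d : nat) := Delone {
  delone_set :> set 'rV[R]_d ;
  deloneP : is_delone delone_set }.

HB.instance Definition _ (R : realType) (d : nat) :=
  gen_eqMixin (delone R d).
HB.instance Definition _ (R : realType) (d : nat) :=
  gen_choiceMixin (delone R d).

Lemma delone_inj (R : realType) (d : nat) (X Y : delone R d) :
  X = Y :> set 'rV[R]_d -> X = Y.
Proof.
case: X Y => [X Xd] [Y Yd] /= XY; subst Y.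
by congr Delone; exact: Prop_irrelevance.
Qed.

Section DeloneMetric.
Context {R : realType} {d : nat}.
Implicit Types (X Y Z : delone R d) (v w : 'rV[R]_d) (e : R).

Definition delone_shift X v : delone R d :=
  Delone (is_delone_shift v (deloneP X)).

Definition close_scales X Y : set R :=
  [set e | [/\ 0 < e, e < (Num.sqrt 2)^-1 & exists v w,
    [/\ eball 0 e v, eball 0 e w &
      shift X v `&` eball 0 e^-1 = shift Y w `&` eball 0 e^-1]]].

Definition delone_dist X Y : R :=
  if close_scales X Y == set0 then (Num.sqrt 2)^-1 else inf (close_scales X Y).

Let s2_gt0 : 0 < (Num.sqrt 2)^-1 :> R.
Proof. by rewrite invr_gt0 sqrtr_gt0. Qed.

Lemma eball0E v e : eball 0 e v = (enorm v < e) :> Prop.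
Proof. by rewrite /eball/= subr0. Qed.

Lemma close_scales_sym X Y : close_scales X Y = close_scales Y X.
Proof.
suff H A B : close_scales A B `<=` close_scales B A.
  by apply/seteqP; split; exact: H.
by move=> e [e0 e1 [v [w [ve we AB]]]]; split=> //; exists w, v.
Qed.

Lemma close_scales_lb X Y : has_lbound (close_scales X Y).
Proof. by exists 0 => e [/ltW]. Qed.

Lemma delone_dist_ge0 X Y : 0 <= delone_dist X Y.
Proof.
rewrite /delone_dist; case: ifPn => [_|/set0P XY0]; first exact: ltW.
by apply: lb_le_inf => // e [/ltW].
Qed.

Lemma delone_dist_le X Y e : close_scales X Y e -> delone_dist X Y <= e.
Proof.
move=> XYe; rewrite /delone_dist ifF.
  by apply: ge_inf => //; exact: close_scales_lb.
by apply/negbTE/set0P; exists e.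
Qed.

Lemma delone_dist_le_max X Y : delone_dist X Y <= (Num.sqrt 2)^-1.
Proof.
have [XY0|/set0P[e XYe]] := eqVneq (close_scales X Y) set0.
  by rewrite /delone_dist XY0 eqxx.
by apply: (le_trans (delone_dist_le XYe)); case: XYe => _ /ltW.
Qed.

Lemma delone_dist_lt X Y e : delone_dist X Y < e ->
  (exists2 a, close_scales X Y a & a < e) \/ (Num.sqrt 2)^-1 < e.
Proof.
rewrite /delone_dist; case: ifPn => [_|/set0P XY0] XYe; [by right|left].
have [] := @inf_adherent _ (close_scales X Y) (e - inf (close_scales X Y)).
- by rewrite subr_gt0.
- by split=> //; exact: close_scales_lb.
- by move=> a XYa; rewrite addrC subrK; exists a.
Qed.

Lemma delone_distxx X : delone_dist X X = 0.
Proof.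
apply/eqP; rewrite eq_le delone_dist_ge0 andbT; apply/ler_addgt0Pr => e e0; rewrite add0r.
have [es2|s2e] := ltP e (Num.sqrt 2)^-1.
  apply: delone_dist_le; split=> //; exists 0, 0.
  by rewrite eball0E enorm0.
exact: le_trans (delone_dist_le_max _ _) s2e.
Qed.

Lemma delone_dist_sym X Y : delone_dist X Y = delone_dist Y X.
Proof. by rewrite /delone_dist close_scales_sym. Qed.

Lemma delone_dist0_sub X Y : delone_dist X Y = 0 -> X `<=` Y.
Proof.
move=> XY0 x Xx; have [[r1 [_ [r1_gt0 _ [_ Y1 _]]]] _] := deloneP Y.
have near e : 0 < e -> exists2 y, (Y : set _) y & enorm (y - x) < e.
  move=> e0; pose e' := Num.min e (Num.min (2 * (enorm x + 1)^-1) (Num.sqrt 2)^-1) / 2.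
  have N0 : 0 < enorm x + 1 by rewrite ltr_wpDl ?enorm_ge0.
  have e'0 : 0 < e'.
    by rewrite divr_gt0// !lt_min e0 s2_gt0 mulr_gt0// invr_gt0.
  have e'e : e' <= e / 2 by rewrite ler_pM2r ?invr_gt0// ge_min lexx.
  have e's : e' < (Num.sqrt 2)^-1.
    rewrite ltr_pdivrMr// (@le_lt_trans _ _ (Num.sqrt 2)^-1)//.
      by rewrite !ge_min lexx !orbT.
    by rewrite ltr_pMr// ltr1n.
  have e'N : e' <= (enorm x + 1)^-1.
    rewrite ler_pdivrMr// [leRHS]mulrC.
    by rewrite !ge_min lexx orbT.
  have : delone_dist X Y < e' by rewrite XY0.
  move=> /delone_dist_lt[[a [a0 as2 [v [w [va wa XYa]]]] ae']|]; last first.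
    by move=> /(lt_trans e's); rewrite ltxx.
  rewrite !eball0E in va wa.
  have a1 : a < 1.
    apply: (lt_trans as2); rewrite invf_lt1 ?sqrtr_gt0//.
    by rewrite -[ltLHS]sqrtr1 ltr_sqrt// ltr1n.
  have : (shift X v `&` eball 0 a^-1) (x - v).
    split; first by exists x.
    rewrite eball0E; apply: (le_lt_trans (enorm_triangle _ _)); rewrite enormN.
    apply: (@lt_trans _ _ (enorm x + 1)).
      by rewrite ltrD2l (lt_trans va).
    rewrite -[ltLHS]invrK ltf_pV2 ?posrE// ?invr_gt0//.
    exact: lt_le_trans ae' e'N.
  rewrite XYa => -[/shiftE Yx _]; exists (x - v + w) => //.
  have -> : x - v + w - x = w - v.
    by rewrite addrAC [x - v - x]addrAC subrr add0r addrC.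
  rewrite (le_lt_trans (enorm_triangle _ _))//.
  rewrite enormN; lra.
have [y Yy yx] := near r1 r1_gt0.
have [->//|xy] := eqVneq x y.
have yx0 : 0 < enorm (y - x).
  rewrite lt_neqAle enorm_ge0 andbT eq_sym; apply: contra xy => /eqP.
  by move=> /enorm0_eq0/eqP; rewrite subr_eq0 eq_sym.
have [z Yz zx] := near _ yx0.
have zy : z = y by apply: (Y1 x) => //; split=> //=; exact: lt_trans zx yx.
by move: zx; rewrite zy ltxx.
Qed.

Lemma delone_dist_eq0 X Y : delone_dist X Y = 0 -> X = Y.
Proof.
move=> XY; apply: delone_inj; apply/seteqP.
by split; apply: delone_dist0_sub; rewrite // delone_dist_sym.
Qed.

Lemma sub_eball_inv (a b : R) v w : 0 < a -> 0 < b ->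
  a + b < (Num.sqrt 2)^-1 -> enorm w < b ->
  eball 0 (a + b)^-1 v -> eball 0 a^-1 (v + w).
Proof.
move=> a0 b0 ab wb; rewrite !eball0E => vab.
apply: (le_lt_trans (enorm_triangle _ _)).
apply: (lt_le_trans (ltrD vab wb)).
have ab0 : 0 < a + b by rewrite addr_gt0.
have aab : a * (a + b) <= 1.
  have : (a + b) * (a + b) <= (Num.sqrt 2)^-1 * (Num.sqrt 2)^-1.
    by rewrite ler_pM ?ltW.
  have -> : (Num.sqrt 2)^-1 * (Num.sqrt 2)^-1 = 2^-1 :> R.
    by rewrite -invfM -expr2 sqr_sqrtr.
  by nra.
rewrite -subr_ge0.
have -> : a^-1 - ((a + b)^-1 + b) = b * (1 - a * (a + b)) / (a * (a + b)).
  by field; rewrite !gt_eqF.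
by rewrite divr_ge0 ?mulr_ge0 ?subr_ge0// ltW.
Qed.

Lemma close_scalesD X Y Z (a b : R) : close_scales X Y a ->
  close_scales Y Z b -> a + b < (Num.sqrt 2)^-1 -> close_scales X Z (a + b).
Proof.
move=> [a0 _ [v [v' [va v'a XY]]]] [b0 _ [w [w' [wb w'b YZ]]]] ab.
rewrite !eball0E in va v'a wb w'b.
have ba : b + a < (Num.sqrt 2)^-1 by rewrite addrC.
split=> //; first by rewrite addr_gt0.
exists (v + w), (v' + w'); rewrite !eball0E.
split; [exact: le_lt_trans (enorm_triangle _ _) (ltrD _ _)..|].
apply/seteqP; split=> x [/shiftE Hx xab]; split=> //; apply/shiftE.
- have H1 : (shift Y v' `&` eball 0 a^-1) (x + w).
    rewrite -XY; split; last exact: sub_eball_inv xab.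
    by apply/shiftE; rewrite -addrA (addrC w).
  have H2 : (shift Z w' `&` eball 0 b^-1) (x + v').
    rewrite -YZ; split; last by apply: (sub_eball_inv _ _ ba) => //; rewrite addrC.
    by apply/shiftE; rewrite addrAC; apply/shiftE; case: H1.
  by rewrite addrA; apply/shiftE; case: H2.
- have H1 : (shift Y w `&` eball 0 b^-1) (x + v').
    rewrite YZ; split; last by apply: (sub_eball_inv _ _ ba) => //; rewrite addrC.
    by apply/shiftE; rewrite -addrA.
  have H2 : (shift X v `&` eball 0 a^-1) (x + w).
    rewrite XY; split; last exact: sub_eball_inv xab.
    by apply/shiftE; rewrite addrAC; apply/shiftE; case: H1.
  by rewrite (addrC v) addrA; apply/shiftE; case: H2.
Qed.

Lemma delone_dist_triangle Y X Z :
  delone_dist X Z <= delone_dist X Y + delone_dist Y Z.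
Proof.
apply/ler_addgt0Pr => e e0.
pose t := e / 2; have t0 : 0 < t by rewrite divr_gt0.
have XYt : delone_dist X Y < delone_dist X Y + t by rewrite ltrDl.
have YZt : delone_dist Y Z < delone_dist Y Z + t by rewrite ltrDl.
have eE : e = t + t by rewrite /t; field.
have := delone_dist_ge0 X Y; have := delone_dist_ge0 Y Z => YZ0 XY0.
have XZ := delone_dist_le_max X Z.
have [se|es] := leP (Num.sqrt 2)^-1 (delone_dist X Y + delone_dist Y Z + e).
  exact: le_trans XZ se.
have [[a XYa ae]|] := delone_dist_lt XYt; last by lra.
have [[b YZb be]|] := delone_dist_lt YZt; last by lra.
have abs : a + b < (Num.sqrt 2)^-1 by lra.
by have := delone_dist_le (close_scalesD XYa YZb abs); lra.
Qed.

HB.instance Definition _ := isMetric.Build R (delone R d)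
  delone_distxx delone_dist_eq0 delone_dist_sym delone_dist_triangle.

End DeloneMetric.

Section DeloneSystems.
Context {R : realType} {d : nat}.
Implicit Types (X Y : delone R d) (v y z : 'rV[R]_d) (r L : R).

Definition non_periodic X : Prop := forall v, shift X v = X -> v = 0.

Definition hull X : set (delone R d) :=
  closure [set delone_shift X (- v) | v in [set: 'rV[R]_d]].

Definition patch X r y : set 'rV[R]_d := X `&` eball y r.

Definition linearly_repetitive X L : Prop :=
  0 < L /\
  forall r y, 0 < r ->
  (exists a b, [/\ patch X r y a, patch X r y b & a <> b]) ->
  forall z, exists v,
    shift (patch X r y) v = patch X r (y - v) /\
    shift (patch X r y) v `<=` eball z (L * diam (patch X r y)).

(* [p] is constrained on [hull X] only: its values elsewhere are irrelevant. *)
Definition factor_map X Y (p : delone R d -> delone R d) : Prop :=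
  [/\ set_fun (hull X) (hull Y) p,
      {within hull X, continuous p},
      set_surj (hull X) (hull Y) p &
      forall Z v, hull X Z -> p (delone_shift Z v) = delone_shift (p Z) v].

End DeloneSystems.

(* Main.v *)
Require Import Defs.
From mathcomp Require Import all_boot all_order all_algebra.
From mathcomp Require Import finmap.
From mathcomp Require Import all_classical all_reals all_analysis.
From mathcomp Require Import ring lra zify.

Set Implicit Arguments.
Unset Strict Implicit.
Unset Printing Implicit Defensive.

Import Order.TTheory GRing.Theory Num.Theory.
Import numFieldNormedType.Exports.
(* [shift] below is the translation of point sets, not that of normed modules *)
Import Defs.

Local Open Scope classical_set_scope.
Local Open Scope ring_scope.

(** Let [N] distinct members [Y i] of the hull of [X] have the same image [W].
    The idea is to find all of them inside a single member [Z] of the hull, with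
    [p Z = X'], and to count places in [X'] that look like [W].

    Linear repetitivity passes from [X] to its whole hull
    ([hull_repetitive]). So, for every large [r], the [r]-patch of [Y i] at the
    origin occurs in [Z] at some centre [c i] of norm at most [2 * L * r], up to
    a constant. The hull is compact ([hull_ultra_limit]), hence [p] is uniformly
    continuous, and so it acts on patches: if two members of the hull agree on a
    ball, their images agree on a slightly smaller ball up to one small
    translation ([factor_agree]). Therefore [X'] shows the patch of [W] of
    radius about [r] at a point [a i] close to [c i].

    If [a i = a j], then [c i] and [c j] are close, so [Y i] and [Y j] agree on
    a large ball up to a small translation; for a finite family of distinct sets
    this is excluded when the scales are well chosen
    ([finite_family_separated]). If [a i] and [a j] differ, their distance is at
    least about [r / (2 * L)]: a shorter vector [a j - a i] would be a local
    period of [X'] on a ball of radius about [r], and repetitivity of [Z] would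
    spread it to a period of [X'] ([repulsion]).

    So the points [a i] are separated by about [r / (2 * L)] in a ball of radius
    about [2 * L * r]. Comparison of volumes ([packing_bound]) bounds their
    number by about [(8 * L ^+ 2 + 1) ^+ d], which is below
    [(55 * L ^+ 2) ^+ d] because repetitivity forces [2 * L >= 1] in positive
    dimension. *)

(** * The Euclidean norm and packings *)

Section EuclideanNorm.
Context {R : realType} {d : nat}.
Implicit Types (u v w : 'rV[R]_d).

Lemma enormB_sym u v : enorm (u - v) = enorm (v - u).
Proof. by rewrite -enormN opprB. Qed.

Lemma enormB_triangle v u w :
  enorm (u - w) <= enorm (u - v) + enorm (v - w).
Proof. by have := enorm_triangle (u - v) (v - w); rewrite addrA subrK. Qed.

Lemma enormZ (a : R) v : 0 <= a -> enorm (a *: v) = a * enorm v.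
Proof.
move=> a0; rewrite /enorm -{2}(ger0_norm a0) -sqrtr_sqr -sqrtrM ?sqr_ge0//.
rewrite mulr_sumr; congr Num.sqrt.
by apply: eq_bigr => i _; rewrite mxE exprMn.
Qed.

Lemma le_coord_enorm v i : `|v 0 i| <= enorm v.
Proof.
rewrite -sqrtr_sqr ler_wsqrtr// (bigD1 i)//= lerDl.
by apply: sumr_ge0 => j _; exact: sqr_ge0.
Qed.

End EuclideanNorm.

Section Packing.
Context {R : realType} {d : nat}.

(** The cubes of side [1 / d] have diameter at most 1, so each of them contains
    at most one point of the family. *)
Lemma card_separated_le (J : finType) (b : J -> 'rV[R]_d) (T : R) :
  0 <= T -> (forall j, enorm (b j) <= T) ->
  (forall i j, i != j -> 2 <= enorm (b i - b j)) ->
  #|J|%:R <= (2 * T * d%:R + 1) ^+ d.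
Proof.
move=> T0 bT sep; pose x j k := (b j 0 k + T) * d%:R.
have x0 j k : 0 <= x j k.
  rewrite mulr_ge0// -lerBlDr sub0r lerNl.
  rewrite (le_trans _ (bT j))// (le_trans _ (le_coord_enorm _ k))//.
  by rewrite -normrN ler_norm.
have xT j k : x j k <= 2 * T * d%:R.
  rewrite ler_wpM2r// -lerBrDr (le_trans (ler_norm _))//.
  by rewrite (le_trans (le_coord_enorm _ _))// (le_trans (bT j))//; lra.
pose m := Num.trunc (2 * T * d%:R).
pose f j : {ffun 'I_d -> 'I_m.+1} := [ffun k => inord (Num.trunc (x j k))].
have f_inj : injective f.
  move=> i j fij; apply/eqP; apply: contraT => /sep.
  rewrite leNgt => /negP[]; rewrite -(@ltr_pXn2r _ 2)// ?nnegrE ?enorm_ge0//.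
  rewrite sqr_enorm; apply: (@le_lt_trans _ _ (\sum_(k < d) d%:R^-1)); last first.
    rewrite sumr_const card_ord -(mulr_natr _^-1).
    have [->|d0] := eqVneq d 0%N; first by rewrite mulr0 exprn_gt0.
    by rewrite mulVf ?pnatr_eq0// expr2; lra.
  apply: ler_sum => k _.
  have /(congr1 val) : f i k = f j k by rewrite fij.
  have trm l : (Num.trunc (x l k) < m.+1)%N by rewrite ltnS le_truncn.
  rewrite !ffunE /= !inordK// => tE.
  have /andP[i1 i2] := truncn_itv (x0 i k).
  have /andP[j1 j2] := truncn_itv (x0 j k).
  rewrite tE in i1 i2; rewrite -[(Num.trunc _).+1]addn1 natrD in i2 j2.
  have d0 : (0 < d)%N := leq_ltn_trans (leq0n k) (ltn_ord k).
  have d1 : 1 <= d%:R :> R by rewrite ler1n.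
  have d_gt0 : 0 < d%:R :> R by rewrite ltr0n.
  rewrite -(@ler_pM2r _ (d%:R ^+ 2)) ?exprn_gt0//.
  rewrite !mxE -exprMn expr2 mulKf ?gt_eqF// (le_trans _ d1)//.
  have -> : (b i 0 k - b j 0 k) * d%:R = x i k - x j k by rewrite /x; ring.
  nra.
have := leq_card f f_inj; rewrite card_ffun !card_ord => Jle.
rewrite (@le_trans _ _ (m.+1 ^ d)%:R) ?ler_nat// natrX lerXn2r ?nnegrE ?ler0n//.
  by rewrite addr_ge0// !mulr_ge0.
by rewrite -addn1 natrD lerD2r truncn_le !mulr_ge0.
Qed.

(** The family [K ^ n *: a i + b j] inherits the separation of its factors:
    two distinct points [K ^ n *: a i] are at distance at least
    [2 * K ^ n], and each of the two errors [b j] has norm at most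
    [K ^ n - 1]. *)
Lemma iterated_packing (I : finType) (a : I -> 'rV[R]_d) (K : R) n :
  0 <= K -> (forall i, enorm (a i) <= K - 1) ->
  (forall i j, i != j -> 2 <= enorm (a i - a j)) ->
  exists (J : finType) (b : J -> 'rV[R]_d), [/\ #|J| = (#|I| ^ n)%N,
    forall j, enorm (b j) <= K ^+ n - 1 &
    forall i j, i != j -> 2 <= enorm (b i - b j)].
Proof.
move=> K0 aK asep; elim: n => [|n [J [b [cJ bK bsep]]]].
  exists unit, (fun=> 0); split; first by rewrite card_unit.
    by move=> _; rewrite enorm0 subrr.
  by move=> [] [].
exists (I * J)%type, (fun ij => K ^+ n *: a ij.1 + b ij.2).
have Kn0 : 0 <= K ^+ n by rewrite exprn_ge0.
split; first by rewrite card_prod cJ expnS.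
  move=> [i j] /=; apply: (le_trans (enorm_triangle _ _)).
  rewrite enormZ// exprS.
  by have := ler_wpM2l Kn0 (aK i); have := bK j; nra.
move=> [i j] [i' j'] /= ij.
have [ii'|ii'] := eqVneq i i'.
  rewrite -ii' opprD addrACA subrr add0r; apply: bsep.
  by apply: contra ij => /eqP ->; rewrite ii'.
have := ler_wpM2l Kn0 (asep _ _ ii'); rewrite -enormZ//.
have -> : K ^+ n *: (a i - a i') =
  ((K ^+ n *: a i + b j) - (K ^+ n *: a i' + b j')) + (b j' - b j).
  rewrite scalerBr opprD (addrACA (K ^+ n *: a i)) -[RHS]addrA.
  by rewrite (addrA (b j - _)) subrK subrr addr0.
move=> H; have := le_trans H (enorm_triangle _ _).
have := enorm_triangle (b j') (- b j); rewrite enormN.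
have := bK j; have := bK j'; lra.
Qed.

Lemma ler1_of_expr_bounded (x C : R) :
  0 <= x -> (forall n, x ^+ n <= C) -> x <= 1.
Proof.
move=> x0 xC; rewrite leNgt; apply/negP => x1.
have bern n : 1 + n%:R * (x - 1) <= x ^+ n.
  elim: n => [|n IH]; first by rewrite mul0r addr0.
  rewrite exprS -natr1; have n0 : 0 <= n%:R :> R by [].
  by have := ler_wpM2l x0 IH; have := mulr_ge0 n0 (sqr_ge0 (x - 1)); nra.
pose n := (Num.trunc (C / (x - 1))).+1.
have := truncnS_gt (C / (x - 1)); rewrite -/n ltr_pdivrMr ?subr_gt0// => Cn.
have := bern n; have := xC n; lra.
Qed.

(** The unit balls around the points [a i] are disjoint and lie in the ball of
    radius [K], so this is a comparison of volumes. It is carried out by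
    iteration: inserting rescaled copies of the packing into its own unit balls
    yields packings of [#|I| ^ n] unit balls in a ball of radius [K ^ n], and the
    constant in the crude bound [C * (K ^ n) ^ d] on their number disappears
    with [n]-th roots. *)
Lemma packing_bound (I : finType) (a : I -> 'rV[R]_d) (K : R) :
  1 <= K -> (forall i, enorm (a i) <= K - 1) ->
  (forall i j, i != j -> 2 <= enorm (a i - a j)) ->
  #|I|%:R <= K ^+ d.
Proof.
move=> K1 aK asep; have K0 : 0 < K by lra.
have Kd0 : 0 < K ^+ d by rewrite exprn_gt0.
rewrite -[leRHS]mul1r -ler_pdivrMr//.
apply: (@ler1_of_expr_bounded _ ((2 * d%:R + 1) ^+ d)).
  by rewrite divr_ge0// ltW.
move=> n; have [J [b [cJ bK bsep]]] := iterated_packing n (ltW K0) aK asep.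
have Kn1 : 1 <= K ^+ n by rewrite exprn_ege1.
have := @card_separated_le J b (K ^+ n) (le_trans ler01 Kn1) _ bsep.
rewrite cJ natrX expr_div_n ler_pdivrMr ?exprn_gt0// => H.
apply: le_trans (H _) _.
  by move=> j; rewrite (le_trans (bK j))// gerBl.
rewrite exprAC -exprMn lerXn2r ?nnegrE//.
- by rewrite addr_ge0// !mulr_ge0// (le_trans ler01).
- by rewrite mulr_ge0 ?addr_ge0 ?mulr_ge0// (le_trans ler01).
- have d0 : 0 <= d%:R :> R by []; nra.
Qed.

End Packing.

(** * Local agreement of point sets *)

Section Agreement.
Context {R : realType} {d : nat}.
Implicit Types (A B C X Y Z : set 'rV[R]_d) (u v w : 'rV[R]_d) (r e : R).

Definition agree r A B : Prop := forall x, enorm x < r -> (A x <-> B x).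

Lemma agree_sym r A B : agree r A B -> agree r B A.
Proof. by move=> AB x xr; have [] := AB x xr. Qed.

Lemma agree_trans r B A C : agree r A B -> agree r B C -> agree r A C.
Proof.
by move=> AB BC x xr; split=> [/(AB x xr)/(BC x xr)|/(BC x xr)/(AB x xr)].
Qed.

Lemma agree_le r1 r2 A B : r2 <= r1 -> agree r1 A B -> agree r2 A B.
Proof. by move=> r21 AB x xr; apply: AB; exact: lt_le_trans r21. Qed.

Lemma agree_shift r1 r2 A B v : r2 + enorm v <= r1 ->
  agree r1 A B -> agree r2 (shift A v) (shift B v).
Proof.
move=> r21 AB x xr; rewrite !shiftE; apply: AB.
by have := enorm_triangle x v; lra.
Qed.

Lemma shiftD A u v : shift (shift A u) v = shift A (u + v).
Proof.
by apply/seteqP; split=> x; rewrite !shiftE addrA addrAC.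
Qed.

Lemma shift0 A : shift A 0 = A.
Proof. by apply/seteqP; split=> x; rewrite shiftE addr0. Qed.

Lemma nbhs_eball v e : 0 < e -> nbhs v (eball v e).
Proof.
move=> e0; apply/nbhs_ballP; pose e1 := e / d.+1%:R.
have d0 : 0 < d.+1%:R :> R by rewrite ltr0n.
have e10 : 0 < e1 by rewrite divr_gt0.
exists e1 => // w [_ vw]; rewrite /eball/=.
rewrite -(@ltr_pXn2r _ 2)// ?nnegrE ?enorm_ge0 ?(ltW e0)// sqr_enorm.
apply: (@le_lt_trans _ _ (\sum_(i < d) e1 ^+ 2)).
  apply: ler_sum => i _; have := vw 0 i; rewrite /ball/= !mxE ltr_norml => /andP[].
  by move=> ? ?; nra.
rewrite sumr_const card_ord -(mulr_natr (e1 ^+ 2)).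
have eE : e = e1 * d.+1%:R by rewrite /e1 divfK ?gt_eqF.
clearbody e1; rewrite eE exprMn ltr_pM2l ?exprn_gt0//.
rewrite -natrX ltr_nat expnS expn1 mulSn mulnS; lia.
Qed.

Lemma bounded_eball r : bounded_set (eball (0 : 'rV[R]_d) r).
Proof.
apply: filterS (nbhs_pinfty_ge (num_real r)) => M rM v /=.
rewrite eball0E => /ltW/le_trans/(_ rM) vr.
change (mx_norm v <= M).
have [->|/mx_norm_neq0[[i j] ->]] := eqVneq (mx_norm v) 0.
  exact: le_trans (enorm_ge0 v) vr.
by rewrite (ord1 i); exact: le_trans (le_coord_enorm v j) vr.
Qed.

Lemma compact_cube r : compact [set v : 'rV[R]_d | forall i, `|v 0 i| <= r].
Proof.
have -> : [set v : 'rV[R]_d | forall i, `|v 0 i| <= r] =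
    [set v : 'rV[R]_d | forall i, `[- r, r]%classic (v ord0 i)].
  by apply/seteqP; split=> v vr i; have := vr i; rewrite /= in_itv/= ler_norml.
by apply: (@rV_compact R d (fun=> `[- r, r]%classic)) => i; exact: segment_compact.
Qed.

End Agreement.

Section DistanceAgreement.
Context {R : realType} {d : nat}.
Implicit Types (X Y Z : delone R d) (u v w : 'rV[R]_d) (r e : R).

Lemma delone_shiftE X v : delone_set (delone_shift X v) = shift X v.
Proof. by []. Qed.

Lemma half_lt_invsqrt2 : 2^-1 < (Num.sqrt 2)^-1 :> R.
Proof.
rewrite ltf_pV2 ?posrE ?sqrtr_gt0// -(@ltr_pXn2r _ 2)// ?nnegrE ?sqrtr_ge0//.
by rewrite sqr_sqrtr// expr2; lra.
Qed.

Lemma exists_scale r (e0 : R) : 0 < e0 ->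
  exists e, [/\ 0 < e, e < (Num.sqrt 2)^-1, e < e0 & r <= e^-1 - e].
Proof.
move=> e00; pose N := `|r| + e0^-1 + 2.
have e0V : 0 < e0^-1 by rewrite invr_gt0.
have N2 : 2 < N by have := normr_ge0 r; rewrite /N; lra.
have N0 : 0 < N by lra.
have e2 : N^-1 < 2^-1 by rewrite ltf_pV2 ?posrE.
exists N^-1; rewrite invr_gt0 invrK N0; split=> //.
- exact: lt_trans half_lt_invsqrt2.
- by rewrite invf_plt ?posrE// /N; have := normr_ge0 r; lra.
- by rewrite /N in e2 *; have := ler_norm r; lra.
Qed.

Lemma agree_of_dist Y Z e : delone_dist Y Z < e -> e <= (Num.sqrt 2)^-1 ->
  exists2 h, enorm h < 2 * e & agree (e^-1 - e) Y (shift Z h).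
Proof.
move=> YZe es; have [|/lt_le_trans/(_ es)] := delone_dist_lt YZe; last by rewrite ltxx.
move=> [a [a0 as2 [v [w [va wa /seteqP[YZ ZY]]]]] ae].
rewrite !eball0E in va wa.
have Vea : e^-1 < a^-1 by rewrite ltf_pV2 ?posrE// (lt_trans a0).
exists (w - v) => [|x xe].
  by have := enorm_triangle w (- v); rewrite enormN; lra.
have xva : eball 0 a^-1 (x - v).
  by rewrite eball0E; have := enorm_triangle x (- v); rewrite enormN; lra.
rewrite shiftE; split=> [Yx|Zx].
  have [|+ _] := YZ (x - v) _; first by split=> //; rewrite shiftE subrK.
  by rewrite shiftE addrAC addrA.
have [|+ _] := ZY (x - v) _; last by rewrite shiftE subrK.
by split=> //; rewrite shiftE addrAC -addrA.
Qed.

Lemma dist_of_agree Y Z e h : 0 < e -> e < (Num.sqrt 2)^-1 -> enorm h < e ->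
  agree e^-1 Y (shift Z h) -> delone_dist Y Z <= e.
Proof.
move=> e0 es he YZ; apply: delone_dist_le; split=> //.
exists 0, h; rewrite !eball0E enorm0; split=> //.
rewrite shift0; apply/seteqP; split=> x [xA xe]; split=> //.
  by apply/YZ => //; rewrite -eball0E.
by apply/YZ => //; rewrite -eball0E.
Qed.

(** Exact agreement, without any small translation, is available because a
    small translation of a translate of [X] is again a translate of [X]. *)
Lemma hullP X Z : hull X Z <-> forall r, exists u, agree r Z (shift X u).
Proof.
split=> [XZ r|XZ].
  have [e [e0 es _ re]] := exists_scale r (ltr01 : 0 < 1 :> R).
  have [] := XZ (ball Z e); first by apply/nbhs_ballP; exists e.
  move=> _ [[v _ <-]]; rewrite ballEmdist /= => Ze.
  have [h _ Zh] := agree_of_dist Ze (ltW es).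
  by exists (- v + h); rewrite -shiftD; exact: agree_le Zh.
move=> B /nbhs_ballP[e0 /= e00 e0B].
have [e [e_gt0 es ee0 re]] := exists_scale 0 e00.
have [u Zu] := XZ e^-1; exists (delone_shift X u); split.
  by exists (- u) => //; rewrite opprK.
apply: e0B; rewrite ballEmdist /=; apply: le_lt_trans ee0.
apply: (@dist_of_agree _ _ e 0) => //; first by rewrite enorm0.
rewrite delone_shiftE shiftD addr0; exact: Zu.
Qed.

Lemma hull_refl X : hull X X.
Proof. by apply/hullP => r; exists 0; rewrite shift0. Qed.

Lemma hull_shift X Z v : hull X Z -> hull X (delone_shift Z v).
Proof.
move=> /hullP XZ; apply/hullP => r; have [u Zu] := XZ (r + enorm v).
by exists (u + v); rewrite -shiftD; exact: agree_shift Zu.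
Qed.

(** The Delone parameters of [X] are inherited by every set whose patches all
    occur in [X], as each clause only involves a bounded part of the set. *)
Lemma locally_delone X (Z : set 'rV[R]_d) (r1 r2 : R) : 0 < r1 ->
  is_rR_delone r1 r2 X ->
  (forall r, exists u, agree r Z (shift X u)) ->
  is_rR_delone r1 r2 Z.
Proof.
move=> r10 [_ X1 X2] XZ.
have Z1 y : is_subset1 (Z `&` eball y r1).
  move=> a b [Za ya] [Zb yb].
  have [u Zu] := XZ (enorm a + enorm b + 1).
  have /Zu : enorm a < enorm a + enorm b + 1 by have := enorm_ge0 b; lra.
  have /Zu : enorm b < enorm a + enorm b + 1 by have := enorm_ge0 a; lra.
  rewrite !shiftE => -[/(_ Zb) Xb _] [/(_ Za) Xa _].
  apply: (addIr u); apply: (X1 (y + u)); split=> //;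
    by rewrite /eball/= opprD addrACA subrr addr0.
split=> //.
  move=> x Zx; split; first exact/mem_set.
  exists (eball x r1); first exact: nbhs_eball.
  have xx : eball x r1 x by rewrite /eball/= subrr enorm0.
  by apply/seteqP; split=> [w [xw Zw]|_ ->//]; apply: (Z1 x).
move=> y; have [u Zu] := XZ (enorm y + `|r2| + 1).
have [x [Xx xy]] := X2 (y + u); exists (x - u).
have xuy : enorm (x - u - y) <= r2 by rewrite -addrA -opprD (addrC u).
split=> //; apply/Zu; last by rewrite shiftE subrK.
have := enorm_triangle (x - u - y) y; rewrite subrK.
have := ler_norm r2; lra.
Qed.

Lemma locally_difference X (Z : set 'rV[R]_d) :
  (forall r, exists u, agree r Z (shift X u)) ->
  difference_set Z `<=` difference_set X.
Proof.
move=> XZ _ [[a b] [/= Za Zb] <-].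
have [u Zu] := XZ (enorm a + enorm b + 1).
have /Zu : enorm a < enorm a + enorm b + 1 by have := enorm_ge0 b; lra.
have /Zu : enorm b < enorm a + enorm b + 1 by have := enorm_ge0 a; lra.
rewrite !shiftE => -[/(_ Zb) Xb _] [/(_ Za) Xa _].
exists (a + u, b + u) => //=.
by rewrite opprD addrACA subrr addr0.
Qed.

End DistanceAgreement.

(** * Compactness of the hull and uniform continuity of factor maps *)

Section Compactness.
Context {R : realType} {d : nat}.
Implicit Types (X Y Z : delone R d) (u v w : 'rV[R]_d) (r e : R).

Lemma ultra_decides (T : Type) (F : set_system T) (A : set T) :
  UltraFilter F -> F [set t | F A <-> A t].
Proof.
move=> FU; have [FA|FnA] := in_ultra_setVsetC A FU.
  by apply: filterS (FA) => t At; split.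
apply: filterS (FnA) => t nAt; split=> // FA.
by have /filter_ex[s [As /(_ As)]] : F (A `&` ~` A) by apply: filterI.
Qed.

Lemma ultra_fmap (T U : Type) (q : T -> U) (F : set_system T) :
  UltraFilter F -> UltraFilter (q @ F).
Proof.
move=> FU; split=> [|G GP FG]; first exact: fmap_proper_filter.
apply/seteqP; split=> A; last exact: FG.
move=> GA; have [//|FnA] := in_ultra_setVsetC (q @^-1` A) FU.
have GnA : G (~` A) by apply: FG; exact: FnA.
by have /filter_ex[s [As /(_ As)]] : G (A `&` ~` A) by apply: filterI.
Qed.

(** This is the compactness of the hull. Each [Y t] has a point [q t] in a fixed
    compact cube, so [q] converges along the ultrafilter to some [q0]. The
    pointed sets [Y t - q t] have their points in the difference set of [X],
    which is locally finite, hence they are eventually constant on every ball;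
    the limit is the eventual value, translated by [q0]. *)
Lemma hull_ultra_limit (T : Type) (F : set_system T) X (Y : T -> delone R d) :
  UltraFilter F -> (forall t, hull X (Y t)) ->
  exists2 Z : delone R d, hull X Z & forall e r, 0 < e ->
    F [set t | exists2 h, enorm h < e & agree r Z (shift (Y t) h)].
Proof.
move=> FU XY; have [[r1 [r2 [r10 r20 Xr]]] Xft] := deloneP X.
have YX t r := (hullP X (Y t)).1 (XY t) r.
have /choice[q Yq] t : exists q, delone_set (Y t) q /\ enorm q <= r2.
  have [_ _ Y2] := locally_delone r10 Xr (YX t).
  by have [q [Yq qr]] := Y2 0; exists q; rewrite /eclosed_ball/= subr0 in qr.
pose P : set 'rV[R]_d := [set z | F [set t | delone_set (Y t) (z + q t)]].
have YqX t z : delone_set (Y t) (z + q t) -> difference_set X z.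
  move=> Yz; apply: (locally_difference (YX t)).
  by exists (z + q t, q t); [split=> //; case: (Yq t)|rewrite /= addrK].
have PY r : F [set t | agree r P (shift (Y t) (q t))].
  have /finite_fsetP[D DE] := Xft _ (bounded_eball r).
  apply: filterS (@filter_bigI T _ D
    (fun z => [set t | P z <-> delone_set (Y t) (z + q t)]) F _ _); last first.
    by move=> z _; exact: ultra_decides.
  move=> t Dt z zr; rewrite shiftE.
  have Dz : difference_set X z -> z \in D.
    move=> Xz; have : (difference_set X `&` eball 0 r) z.
      by split=> //; rewrite eball0E.
    by rewrite DE.
  have [/Dz/Dt//|nXz] := pselect (difference_set X z).
  split=> [/filter_ex[s]|] /YqX //.
have [q0 q0P] : exists q0 : 'rV[R]_d, q t @[t --> F] --> q0.
  have := @compact_cube R d r2; rewrite compact_ultra => /(_ (q @ F) (ultra_fmap q FU)).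
  case=> [|q0 [_ ?]]; last by exists q0.
  apply: (@filterE _ F) => t i; have [_] := Yq t.
  exact: le_trans (le_coord_enorm (q t) i).
have qF e : 0 < e -> F [set t | enorm (q t - q0) < e].
  by move=> e0; exact: (q0P _ (nbhs_eball q0 e0)).
pose Z := shift P (- q0).
have lim e r : 0 < e ->
    F [set t | exists2 h, enorm h < e & agree r Z (shift (Y t) h)].
  move=> e0; apply: filterS (filterI (qF e e0) (PY (r + enorm q0))) => t [qe Pt].
  exists (q t - q0) => //; rewrite -shiftD.
  by apply: agree_shift Pt; rewrite enormN.
have ZX r : exists u, agree r Z (shift X u).
  have /filter_ex[t [h _ Zh]] := lim 1 r ltr01.
  have [u Yu] := YX t (r + enorm h); exists (u + h); rewrite -shiftD.
  by apply: agree_trans Zh (agree_shift _ Yu).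
have Zd : is_delone Z.
  split; first by exists r1, r2; split=> //; exact: locally_delone r10 Xr ZX.
  move=> B /Xft; apply: sub_finite_set => z [+ Bz].
  by move=> /(locally_difference ZX).
by exists (Delone Zd); [apply/hullP; exact: ZX|exact: lim].
Qed.

End Compactness.

Section FactorMap.
Context {R : realType} {d : nat}.
Context (X X' : delone R d) (p : delone R d -> delone R d).
Context (pF : factor_map X X' p).
Implicit Types (Y Z : delone R d) (u v w : 'rV[R]_d) (r e : R).

Lemma factor_continuous_at Z e : hull X Z -> 0 < e -> exists2 c, 0 < c &
  forall Y, hull X Y -> delone_dist Z Y < c -> delone_dist (p Z) (p Y) < e.
Proof.
move=> XZ e0; have [_ + _ _] := pF.
move=> /subspace_continuousP/(_ _ XZ) pZ.
have : nbhs Z [set Y | hull X Y -> ball (p Z) e (p Y)].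
  by apply: (pZ (ball (p Z) e)); apply/nbhs_ballP; exists e.
move=> /nbhs_ballP[c /= c0 cB]; exists c => // Y XY ZY.
by have := cB Y; rewrite !ballEmdist /=; apply.
Qed.

Lemma factor_unif_continuous e : 0 < e -> exists S, forall Y Z,
  hull X Y -> hull X Z -> agree S Y Z -> delone_dist (p Y) (p Z) < e.
Proof.
move=> e0; apply: contrapT => /forallNP npF.
have /choice[YZ YZP] (n : nat) : exists YZ : delone R d * delone R d,
    [/\ hull X YZ.1, hull X YZ.2, agree n%:R YZ.1 YZ.2 &
        e <= delone_dist (p YZ.1) (p YZ.2)].
  have /existsNP[Y /existsNP[Z]] := npF n%:R.
  move=> /not_implyP[XY] /not_implyP[XZ] /not_implyP[YZ] /negP.
  by rewrite -leNgt => ?; exists (Y, Z).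
have [F [FU Foo]] := ultraFilterLemma (@eventually_filter).
have XYZ1 n : hull X (YZ n).1 by case: (YZP n).
have [L XL Llim] := hull_ultra_limit FU XYZ1.
have e20 : 0 < e / 2 by rewrite divr_gt0.
have [c c0 Lc] := factor_continuous_at XL e20.
have [a [a0 as2 ac _]] := exists_scale 0 c0.
pose r := a^-1.
have /Foo Fr : \oo [set n : nat | r + a <= n%:R].
  exact: nbhs_infty_ger.
have := filterI (Llim a r a0) Fr => /(_ _)/filter_ex[n [[h ha Lh] rn]].
have [XY XZ YZn] := YZP n; apply/negP; rewrite -ltNge.
have LY : delone_dist L (YZ n).1 < c.
  exact: le_lt_trans (dist_of_agree a0 as2 ha Lh) ac.
have LZ : delone_dist L (YZ n).2 < c.
  apply: le_lt_trans (dist_of_agree a0 as2 ha _) ac.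
  apply: agree_trans Lh (agree_shift _ YZn).
  by apply: le_trans rn; rewrite lerD2l ltW.
have := Lc _ XY LY; have := Lc _ XZ LZ.
have := delone_dist_triangle (p L) (p (YZ n).1) (p (YZ n).2).
by rewrite (delone_dist_sym _ (p L)); lra.
Qed.

(** Uniform continuity, read on patches; the small translation [h] depends on
    the pair of sets. *)
Lemma factor_local_agree e r : 0 < e -> exists S, forall Y Z,
  hull X Y -> hull X Z -> agree S Y Z ->
  exists2 h, enorm h < e & agree r (p Y) (shift (p Z) h).
Proof.
move=> e0; have e20 : 0 < e / 2 by rewrite divr_gt0.
have [a [a0 as2 ae ra]] := exists_scale r e20.
have [S SP] := factor_unif_continuous a0; exists S => Y Z XY XZ YZ.
have [h ha ph] := agree_of_dist (SP _ _ XY XZ YZ) (ltW as2).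
by exists h; [lra|exact: agree_le ph].
Qed.

(** The translation of [factor_local_agree] can be chosen constant along the
    whole region of agreement. The translations found at two neighbouring
    centres both match a common point of [p Y] with a point of [p Z]; being
    shorter than half the separation of [X'], they coincide, and the equality
    propagates from the origin along segments. *)
Lemma factor_agree e : 0 < e -> exists2 s0, 0 < s0 & forall S Y Z,
  hull X Y -> hull X Z -> agree S Y Z ->
  exists2 h, enorm h < e & agree (S - s0) (p Y) (shift (p Z) h).
Proof.
move=> e0; have [[r1 [r2 [r10 r20 X'r]]] _] := deloneP X'.
pose e1 := Num.min e (r1 / 2).
have e10 : 0 < e1 by rewrite lt_min e0 divr_gt0.
have e1e : e1 <= e by rewrite ge_min lexx.
have e1r : e1 <= r1 / 2 by rewrite ge_min lexx orbT.
have [s sP] := factor_local_agree (r2 + 2) e10.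
have [pfun _ _ pshift] := pF.
have pdelone Y : hull X Y -> is_rR_delone r1 r2 (p Y).
  move=> /pfun X'pY; apply: (locally_delone r10 X'r).
  by move=> r; exact: (hullP X' (p Y)).1.
exists (`|s| + 1) => [|S Y Z XY XZ YZ]; first by rewrite ltr_wpDl.
have [Ss|sS] := ltP S s.
  exists 0; rewrite ?enorm0// => x; have := enorm_ge0 x; have := ler_norm s; lra.
pose good t h := enorm h < e1 /\
  agree (r2 + 2) (shift (p Y) t) (shift (p Z) (h + t)).
have goodE t : enorm t <= S - s -> exists h, good t h.
  move=> tS; have [] := sP (delone_shift Y t) (delone_shift Z t).
  - exact: hull_shift.
  - exact: hull_shift.
  - by apply: agree_shift YZ; rewrite -lerBrDl.
  - by move=> h he; rewrite !pshift// !delone_shiftE shiftD (addrC t); exists h.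
have good_uniq t t' h h' : enorm (t - t') <= 1 -> good t h -> good t' h' -> h = h'.
  move=> tt' [he th] [h'e th'].
  have [_ _ Y2] := pdelone _ XY; have [_ Z1 _] := pdelone _ XZ.
  have [x [Yx xt]] := Y2 t; rewrite /eclosed_ball/= in xt.
  have Zx : delone_set (p Z) (x + h).
    have [|+ _] := th (x - t); first lra.
    by rewrite !shiftE (addrC h) addrA !subrK; apply.
  have Zx' : delone_set (p Z) (x + h').
    have [|+ _] := th' (x - t'); first by have := enormB_triangle t x t'; lra.
    by rewrite !shiftE (addrC h') addrA !subrK; apply.
  apply: (addrI x); apply: (Z1 (x + h)); split=> //; rewrite /eball/=.
    by rewrite subrr enorm0.
  rewrite opprD addrACA subrr add0r.
  have := enorm_triangle h' (- h); rewrite enormN; lra.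
have [|h0 h0P] := goodE 0; first by rewrite enorm0 subr_ge0.
exists h0 => [|x xS]; first exact: lt_le_trans h0P.1 e1e.
have xSs : enorm x <= S - s by have := ler_norm s; lra.
pose N := (Num.trunc (enorm x)).+1.
have N0 : 0 < N%:R :> R by rewrite ltr0n.
have xN : enorm x <= N%:R by rewrite ltW// truncnS_gt.
have goodk k : (k <= N)%N -> good ((k%:R / N%:R) *: x) h0.
  elim: k => [_|k IH kN]; first by rewrite mul0r scale0r.
  have [|h hP] := goodE ((k.+1%:R / N%:R) *: x).
    rewrite enormZ ?divr_ge0// (le_trans _ xSs)// ler_piMl ?enorm_ge0//.
    by rewrite ler_pdivrMr// mul1r ler_nat.
  suff -> : h0 = h by [].
  apply: good_uniq (IH (ltnW kN)) hP; rewrite enormB_sym -scalerBl -mulrBl.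
  rewrite -natrB// subSnn mul1r enormZ ?invr_ge0 ?(ltW N0)//.
  by rewrite ler_pdivrMl// mulr1.
have [_ /(_ 0)] := goodk N (leqnn N).
by rewrite divff ?gt_eqF// scale1r !shiftE !add0r enorm0 (addrC h0); apply; lra.
Qed.

End FactorMap.

(** * Repetitivity of the hull *)

Section Repetitivity.
Context {R : realType} {d : nat}.
Implicit Types (A : set 'rV[R]_d) (X Y Z : delone R d) (u v w y z : 'rV[R]_d).
Implicit Types (r s L : R).

Lemma exists_enorm (c : R) :
  (0 < d)%N -> 0 <= c -> exists v : 'rV[R]_d, enorm v = c.
Proof.
move=> d0 c0; pose i := Ordinal d0.
exists (c *: delta_mx 0 i); rewrite enormZ// /enorm (bigD1 i)//= mxE !eqxx.
rewrite big1 => [|j ji]; last by rewrite mxE eqxx (negbTE ji) expr0n.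
by rewrite expr1n addr0 sqrtr1 mulr1.
Qed.

Lemma patch_two_points A (r1 r2 : R) s y : (0 < d)%N -> 0 < r2 ->
  is_rR_delone r1 r2 A -> 3 * r2 + 1 < s ->
  exists a b, [/\ (A `&` eball y s) a, (A `&` eball y s) b & a <> b].
Proof.
move=> d0 r20 [_ _ A2] rs.
have [v vr] : exists v : 'rV[R]_d, enorm v = 2 * r2 + 1.
  by apply: exists_enorm => //; lra.
have [a [Aa ay]] := A2 y; have [b [Ab bv]] := A2 (y + v).
rewrite /eclosed_ball/= in ay bv.
exists a, b; rewrite /eball; split.
- by split=> //=; lra.
- split=> //=; have := enorm_triangle (b - (y + v)) v.
  have -> : b - (y + v) + v = b - y by rewrite opprD addrA subrK.
  by rewrite vr; lra.
- move=> ab; rewrite ab in ay.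
  have := enorm_triangle (y + v - b) (b - y).
  rewrite addrA subrK (addrC y) addrK vr (enormB_sym (v + y)) (addrC v); lra.
Qed.

Lemma enormB_le_diam A r y a b :
  A `<=` eball y r -> A a -> A b -> enorm (a - b) <= diam A.
Proof.
move=> Ar Aa Ab; apply: ub_le_sup; last by exists (a, b).
exists (2 * r) => _ [[u v] [/= Au Av] <-].
have := Ar _ Au; have := Ar _ Av; rewrite /eball/= => vy uy.
by have := enormB_triangle y u v; rewrite (enormB_sym y v); lra.
Qed.

Lemma diam_le A r y : A !=set0 -> A `<=` eball y r -> diam A <= 2 * r.
Proof.
move=> [a Aa] Ar; apply: ge_sup; first by exists (enorm (a - a)), (a, a).
move=> _ [[u v] [/= Au Av] <-].
have := Ar _ Au; have := Ar _ Av; rewrite /eball/= => vy uy.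
by have := enormB_triangle y u v; rewrite (enormB_sym y v); lra.
Qed.

Lemma patch_sub_eball X r y : patch X r y `<=` eball y r.
Proof. by move=> x []. Qed.

(** A ball of radius [L * diam P] has to be large enough to contain a
    translate of [P]. *)
Lemma repetitivity_constant_ge X L : (0 < d)%N ->
  linearly_repetitive X L -> 1 <= 2 * L.
Proof.
move=> d0 [L0 XL]; have [[r1 [r2 [r10 r20 Xr]]] _] := deloneP X.
pose s := 3 * r2 + 2; have s0 : 0 < s by rewrite /s; lra.
have [|a [b [Pa Pb ab]]] := @patch_two_points X _ _ s 0 d0 r20 Xr.
  by rewrite /s; lra.
have [|v [_ vL]] := XL s 0 s0 _ 0; first by exists a, b.
set D := diam _ in vL.
have D0 : 0 < D.
  apply: lt_le_trans (enormB_le_diam (@patch_sub_eball X s 0) Pa Pb).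
  rewrite lt_neqAle enorm_ge0 andbT eq_sym; apply/eqP => /enorm0_eq0/eqP.
  by rewrite subr_eq0 => /eqP.
rewrite -(ler_pM2r D0) mul1r -mulrA.
have {1}-> : D = diam (shift (patch X s 0) v).
  congr sup; apply/seteqP; split=> _ [[x y] [/= Px Py] <-].
    exists (x - v, y - v); last by rewrite /= opprB addrA subrK.
    by split; rewrite /= shiftE subrK.
  rewrite !shiftE in Px Py.
  by exists (x + v, y + v) => //=; rewrite opprD addrACA subrr addr0.
apply: diam_le vL.
by exists (a - v); rewrite shiftE subrK.
Qed.

(** Repetitivity transfers from [X] because every bounded part of a member of
    the hull is a translate of a part of [X]. The diameter of an [s]-patch is
    replaced by its upper bound [2 * s], and the translated patch is located by
    its centre [c], which is at distance at most [C] from some point of the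
    patch. *)
Lemma hull_repetitive X L : (0 < d)%N -> linearly_repetitive X L ->
  exists S0 C : R, [/\ 0 < S0, 0 < C & forall Y Z s y z,
    hull X Y -> hull X Z -> S0 < s ->
    exists2 c, enorm (c - z) < 2 * L * s + C &
      agree s (shift Y y) (shift Z c)].
Proof.
move=> d0 [L0 XL]; have [[r1 [r2 [r10 r20 Xr]]] _] := deloneP X.
exists (3 * r2 + 1), r2; split=> // [|Y Z s y z XY XZ sr]; first lra.
have s0 : 0 < s by lra.
have [u Yu] := (hullP X Y).1 XY (s + enorm y).
have [t Zt] := (hullP X Z).1 XZ (s + (2 * L * s + r2 + enorm z)).
have [|v [Pv vL]] := XL s (u + y) s0 _ (z + t).
  exact: patch_two_points Xr sr.
(* the patch is centred at [u + y] in [X], and its copy at [u + y - v] *)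
have [_ _ X2] := Xr; have [x [Xx xy]] := X2 (u + y).
rewrite /eclosed_ball/= in xy.
have Px : patch X s (u + y) x by split=> //; rewrite /eball/=; lra.
have : eball (z + t) (L * diam (patch X s (u + y))) (x - v).
  by apply: vL; rewrite shiftE subrK.
rewrite /eball/= => xzL.
have D2s : diam (patch X s (u + y)) <= 2 * s.
  by apply: diam_le (@patch_sub_eball X s (u + y)); exists x.
have cz : enorm (u + y - v - t - z) < 2 * L * s + r2.
  have := enorm_triangle (u + y - x) (x - v - (z + t)).
  have -> : u + y - x + (x - v - (z + t)) = u + y - v - t - z.
    by rewrite -(addrA x) (addrA (u + y - x)) subrK opprD (addrC (- z)) !addrA.
  rewrite (enormB_sym (u + y)); have := ler_wpM2l (ltW L0) D2s; lra.
exists (u + y - v - t) => //.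
have YX : agree s (shift Y y) (shift X (u + y)).
  by rewrite -shiftD; apply: agree_shift Yu.
have ZX : agree s (shift Z (u + y - v - t)) (shift X (u + y - v)).
  have -> : shift X (u + y - v) = shift (shift X t) (u + y - v - t).
    by rewrite shiftD (addrC t) subrK.
  apply: agree_shift Zt.
  by have := enorm_triangle (u + y - v - t - z) z; rewrite subrK; lra.
apply: agree_trans YX _; apply: agree_trans (agree_sym ZX).
move=> q qs; rewrite !shiftE.
have : shift (patch X s (u + y)) v (q + (u + y - v)) <->
       patch X s (u + y - v) (q + (u + y - v)) by rewrite Pv.
have E : q + (u + y - v) + v = q + (u + y) by rewrite (addrA q) subrK.
rewrite shiftE E /patch /eball /= !addrK => -[H1 H2].
by split=> H; [have [] := H1 (conj H qs)|have [] := H2 (conj H qs)].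
Qed.

End Repetitivity.

(** * Repulsion of translated patches *)

Section Fibres.
Context {R : realType} {d : nat}.
Context (X X' : delone R d) (L : R) (p : delone R d -> delone R d).
Context (d_gt0 : (0 < d)%N) (XL : linearly_repetitive X L).
Context (X'np : non_periodic X') (pF : factor_map X X' p).
Implicit Types (Y Z : delone R d) (a u v w y z : 'rV[R]_d) (r s : R).

(** A patch of a preimage of [X'] around an arbitrary point [t] recurs near
    [a], so the factor map transports the invariance under [w], which is
    assumed near [a] only, to [t]; then [w] is a period of [X']. *)
Lemma repulsion : exists S0 C : R, [/\ 0 < S0, 0 < C & forall a w s,
  S0 + enorm w < s ->
  agree (2 * L * s + C) (shift X' a) (shift X' (a + w)) -> w = 0].
Proof.
have [_ _ psurj pshift] := pF; have [Z XZ pZ] := psurj _ (@hull_refl _ _ X').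
have [s0 s00 sP] := factor_agree pF ltr01.
have [S0 [C [S00 C0 Xrep]]] := hull_repetitive d_gt0 XL.
exists (S0 + s0), (C + 1); split; [lra|lra|] => a w s sw aw; apply: X'np.
have w0 := enorm_ge0 w.
apply/seteqP; suff H t : delone_set X' t <-> delone_set X' (t + w).
  by split=> t; rewrite shiftE; case: (H t).
have [|c ca Zc] := Xrep Z Z s t a XZ XZ; first lra.
have := sP s (delone_shift Z t) (delone_shift Z c) (hull_shift XZ) (hull_shift XZ) Zc.
move=> [h h1]; rewrite !pshift// pZ !delone_shiftE shiftD => th.
have /th : enorm (0 : 'rV[R]_d) < s - s0 by rewrite enorm0; lra.
have /th : enorm w < s - s0 by lra.
rewrite !shiftE !add0r (addrC w t) => -> ->.
have /aw : enorm (c + h - a) < 2 * L * s + (C + 1).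
  by have := enorm_triangle (c - a) h; rewrite addrAC; lra.
by rewrite !shiftE subrK addrA subrK (addrC w).
Qed.

(** Two members agreeing in this way are at distance at most [e], while the
    distances between distinct members have a positive lower bound. *)
Lemma finite_family_separated (I : finType) (Y : I -> delone R d) : injective Y ->
  exists2 e : R, 0 < e & forall i j h, enorm h < e ->
    agree e^-1 (Y i) (shift (Y j) h) -> i = j.
Proof.
move=> Yinj.
have : \forall e \near (0 : R)^'+, forall ij : I * I,
    ij.1 != ij.2 -> e < delone_dist (Y ij.1) (Y ij.2).
  apply: filter_forall => -[i j] /=.
  have [ij|ij] := eqVneq i j.
    by near=> e.
  have dij : 0 < delone_dist (Y i) (Y j).
    rewrite lt_neqAle delone_dist_ge0 andbT eq_sym.
    by apply: contra ij => /eqP/delone_dist_eq0/Yinj ->.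
  by near=> e => _; near: e; exact: nbhs_right_lt.
move=> dF; have /filter_ex[e [[e0 es] eF]] : \forall e \near (0 : R)^'+,
    (0 < e /\ e < (Num.sqrt 2)^-1) /\ (forall ij : I * I,
      ij.1 != ij.2 -> e < delone_dist (Y ij.1) (Y ij.2)).
  near=> e; split; last by near: e.
  split; near: e; first exact: nbhs_right_gt.
  by apply: nbhs_right_lt; rewrite invr_gt0 sqrtr_gt0.
exists e => // i j h he Yij; apply/eqP; apply: contraT => /(eF (i, j)).
by rewrite ltNge (dist_of_agree e0 es he Yij).
Unshelve. all: by end_near. Qed.

End Fibres.

(** * Counting the members of a fibre *)

Section FibreBound.
Context {R : realType} {d : nat}.
Context (X X' : delone R d) (L : R) (p : delone R d -> delone R d).
Context (d_gt0 : (0 < d)%N) (XL : linearly_repetitive X L).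
Context (X'np : non_periodic X') (pF : factor_map X X' p).

(** For large [r] the equation makes [delta] close to [r / (2 * l)], so the
    left-hand side of the last inequality is close to [8 * l ^+ 2 * delta],
    whereas [55 * l ^+ 2 - 1] is at least [51 * l ^+ 2]. *)
Lemma radius_exists (S0 S1 C C1 s0 e l : R) : 1 <= 2 * l -> 0 < S0 -> 0 < S1 ->
  0 < C -> 0 < C1 -> 0 < s0 -> 0 < e ->
  exists r delta : R, [/\ S0 < r, e^-1 + e <= r, 0 < delta,
    2 * l * (delta + S1) + C1 = r - s0 &
    2 * (2 * l * r + C + e) <= (55 * l ^+ 2 - 1) * delta].
Proof.
move=> l1 S00 S10 C0 C10 s00 e0; have l0 : 0 < l by lra.
have eV0 : 0 < e^-1 by rewrite invr_gt0.
(* the coefficients are generous: they only have to absorb the constants *)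
pose r := S0 + e^-1 + 5 * e + 4 * C + 2 * (s0 + C1) + 3 * l * S1.
pose delta := (r - s0 - C1) / (2 * l) - S1.
have dE : 2 * l * (delta + S1) = r - s0 - C1.
  by rewrite /delta subrK mulrC divfK// gt_eqF// mulr_gt0.
have lS1 : 0 < l * S1 by rewrite mulr_gt0.
have d0 : 0 < delta.
  have : 0 < 2 * l * delta.
    have -> : 2 * l * delta = r - s0 - C1 - 2 * (l * S1) by rewrite -dE; ring.
    by rewrite /r; lra.
  by rewrite pmulr_rgt0//; lra.
exists r, delta; split=> //; rewrite ?dE /r; try lra.
rewrite -/r; apply: (@le_trans _ _ (51 / 2 * l * (2 * l * delta))); last first.
  have : 1 <= (2 * l) ^+ 2 by rewrite exprn_ege1.
  by rewrite exprMn => l2; nra.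
have -> : 2 * l * delta = r - s0 - C1 - 2 * l * S1 by rewrite -dE; ring.
have lpos x : 0 < x -> 0 < l * x /\ x <= 2 * (l * x).
  by move=> x0; rewrite mulr_gt0//; split=> //; nra.
have [? ?] := lpos _ S00; have [? ?] := lpos _ eV0; have [? ?] := lpos _ e0.
have [? ?] := lpos _ C0; have [? ?] := lpos _ s00; have [? ?] := lpos _ C10.
have [? ?] := lpos _ lS1.
have -> : 2 * (2 * l * r + C + e) = 4 * (l * r) + 2 * C + 2 * e by ring.
have -> : 51 / 2 * l * (r - s0 - C1 - 2 * l * S1) =
  51 / 2 * (l * r) - 51 / 2 * (l * s0) - 51 / 2 * (l * C1) - 51 * (l * (l * S1)).
  by field.
have -> : l * r = l * S0 + l * e^-1 + 5 * (l * e) + 4 * (l * C) +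
  2 * (l * s0 + l * C1) + 3 * (l * (l * S1)) by rewrite /r; ring.
by lra.
Qed.

(** The [r]-patches at the origin of the members [Y i] of a fibre all occur in
    one set [Z], at centres [c i] of norm about [2 * L * r], and their images
    give centres [a i] at which [X'] shows the same patch. Two centres [a i]
    never coincide, for otherwise [Y i] and [Y j] would agree up to a small
    translation; hence they are [delta]-separated by repulsion, where [delta]
    is about [r / (2 * L)]. The ratio of the two scales does not depend on [r],
    and packing concludes. *)
Lemma fibre_family_bound (I : finType) (Y : I -> delone R d) (W : delone R d) :
  injective Y -> (forall i, hull X (Y i)) -> (forall i, p (Y i) = W) ->
  #|I|%:R <= (55 * L ^+ 2) ^+ d.
Proof.
move=> Yinj XY pY; have [_ _ psurj pshift] := pF.
have [Z XZ pZ] := psurj _ (@hull_refl _ _ X').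
have L1 := repetitivity_constant_ge d_gt0 XL.
have [e e0 eP] := finite_family_separated Yinj.
have e20 : 0 < e / 2 by rewrite divr_gt0.
have [s0 s00 sP] := factor_agree pF e20.
have [S0 [C [S00 C0 Xrep]]] := hull_repetitive d_gt0 XL.
have [S1 [C1 [S10 C10 rep]]] := repulsion d_gt0 XL X'np pF.
have [r [delta [S0r er d0 dE rK]]] := radius_exists L1 S00 S10 C0 C10 s00 e0.
have /choice[c cP] i : exists c, enorm c < 2 * L * r + C /\
    agree r (Y i) (shift Z c).
  have [c c0 Yc] := Xrep (Y i) Z r 0 0 (XY i) XZ S0r.
  by exists c; rewrite subr0 in c0; rewrite shift0 in Yc.
have /choice[h hP] i : exists h, enorm h < e / 2 /\
    agree (r - s0) W (shift X' (c i + h)).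
  have [h he] := sP r (Y i) (delone_shift Z (c i)) (XY i) (hull_shift XZ) (cP i).2.
  by rewrite pshift// pZ pY delone_shiftE shiftD; exists h.
pose a i := c i + h i.
have a_neq i j : a i = a j -> i = j.
  move=> aij; apply: (eP i j (h j - h i)).
    have := enorm_triangle (h j) (- h i); rewrite enormN.
    by have := (hP i).1; have := (hP j).1; lra.
  have hE : h j - h i = c i - c j.
    have -> : c i = c j + (h j - h i).
      by rewrite addrA -[c j + h j]/(a j) -aij addrK.
    by rewrite [RHS]addrC addKr.
  apply: (@agree_trans _ _ _ (shift Z (c i))).
    by apply: agree_le (cP i).2; lra.
  have -> : shift Z (c i) = shift (shift Z (c j)) (h j - h i).
    by rewrite shiftD hE addrC subrK.
  apply: agree_sym; apply: agree_shift (cP j).2.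
  have := enorm_triangle (h j) (- h i); rewrite enormN.
  by have := (hP i).1; have := (hP j).1; lra.
have a_sep i j : i != j -> delta <= enorm (a i - a j).
  move=> ij; rewrite leNgt; apply/negP => dij; move/eqP: ij; apply.
  apply: a_neq; apply/eqP; rewrite eq_sym -subr_eq0; apply/eqP.
  apply: (rep (a i) (a j - a i) (delta + S1)).
    by rewrite enormB_sym addrC ltrD2r.
  rewrite dE (addrC (a i)) subrK.
  exact: agree_trans (agree_sym (hP i).2) (hP j).2.
have t0 : 0 <= 2 / delta by rewrite divr_ge0// ltW.
apply: (@packing_bound R d I (fun i => (2 / delta) *: a i)).
- have : 1 <= (2 * L) ^+ 2 by rewrite exprn_ege1.
  by rewrite exprMn; lra.
- move=> i; rewrite enormZ// mulrAC ler_pdivrMr//; apply: le_trans rK.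
  rewrite ler_pM2l//; have := enorm_triangle (c i) (h i).
  by have := (hP i).1; have := (cP i).1; rewrite /a; lra.
- move=> i j /a_sep ij; rewrite -scalerBr enormZ// mulrAC ler_pdivlMr//.
  by rewrite ler_pM2l.
Qed.

End FibreBound.

(** In dimension 0 the only Delone set is the whole one-point space. *)
Lemma delone0_eq (R : realType) (Y Z : delone R 0) : Y = Z.
Proof.
apply: delone_inj; suff H (A : delone R 0) v : delone_set A v.
  by apply/seteqP; split=> v _; exact: H.
have [[r1 [r2 [_ _ [_ _ /(_ 0)[x [Ax _]]]]]] _] := deloneP A.
by rewrite (_ : v = x)//; apply/rowP; case.
Qed.

Theorem proposition5 (R : realType) (d : nat) (X X' : delone R d) (L : R)
    (p : delone R d -> delone R d) :
  linearly_repetitive X L -> non_periodic X' -> factor_map X X' p ->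
  forall Y : delone R d, hull X' Y ->
    finite_set (hull X `&` p @^-1` [set Y]) /\
    #|` fset_set (hull X `&` p @^-1` [set Y]) |%fset%:R <= (55 * L ^+ 2) ^+ d.
Proof.
move=> XL X'np pF Y _; set A := _ `&` _.
have fsetB (B : {fset delone R d}) : [set` B] `<=` A ->
    #|` B|%fset%:R <= (55 * L ^+ 2) ^+ d.
  move=> BA; rewrite cardfE.
  have [d0|d0] := posnP d.
    have -> : (55 * L ^+ 2) ^+ d = 1 by rewrite d0 expr0.
    rewrite lern1; apply/card_le1P => x _ y.
    have xyE (Z Z' : delone R d) : Z = Z' by subst d; exact: delone0_eq.
    by rewrite !inE; apply/esym/eqP/val_inj/xyE.
  apply: (fibre_family_bound d0 XL X'np pF (Y := val) (W := Y)).
  - exact: val_inj.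
  - by move=> b; have [] := BA _ (valP b).
  - by move=> b; have [] := BA _ (valP b).
have finA : finite_set A.
  apply: contrapT => infA.
  have [B BA] := infinite_set_fset (Num.trunc ((55 * L ^+ 2) ^+ d)).+1 infA.
  rewrite leqNgt => /negP; apply; rewrite ltnS.
  have := fsetB B BA; have K0 : 0 <= (55 * L ^+ 2) ^+ d.
    by rewrite exprn_ge0// mulr_ge0// sqr_ge0.
  by rewrite -truncn_ge_nat.
by split=> //; apply: fsetB; rewrite fset_setK.
Qed.
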